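(* Let $k\in\mathbb{N}$, $d\in\{1,2\}$, let $b:\mathbb{F}_d^k\to\mathbb{T}_d$ be measurable, and let $h_b:\overline{\mathbb{D}_d}\to\overline{\mathbb{D}_d}$ be the function defined by $h_b(z)=\mathbb{E}\big[b(Z)\,\overline{b(W)}\big]$, where $(Z^\top,W^\top)^\top\sim\mathbb{F}_dN_{2k}(0,\Sigma_{2k}(z))$ with $Z,W$ taking values in $\mathbb{F}_d^k$. Assume that: (1) $h_b(0)=0$ and $h_b:\overline{\mathbb{D}_d}\to\overline{\mathbb{D}_d}$ is a homeomorphism; (2) the inverse $g_b:=h_b^{-1}:\overline{\mathbb{D}_d}\to\overline{\mathbb{D}_d}$ can be represented as $g_b(z)=\sum_{n=1}^\infty\beta_nz^n$ for all $z\in\overline{\mathbb{D}_d}$, where $\beta_n\in\mathbb{R}$ for all $n\in\mathbb{N}$ and $\sum_{n=1}^\infty|\beta_n|<\infty$. Let $f_b(z):=\sum_{n=1}^\infty|\beta_n|\,z^n$ for $z\in\overline{\mathbb{D}_d}$, and assume that $f_b(r^\ast)=1$ for some $0<r^\ast<1$. Then $$K_G^{\mathbb{F}_d}\le\frac{1}{r^\ast}.$$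
   Context: $\mathbb{F}_1:=\mathbb{R}$, $\mathbb{F}_2:=\mathbb{C}$; $\mathbb{D}_d:=\{z\in\mathbb{F}_d:|z|<1\}$, $\overline{\mathbb{D}_d}$ is its closure, and $\mathbb{T}_d:=\{z\in\mathbb{F}_d:|z|=1\}$ (so $\mathbb{T}_1=\{-1,1\}$). For $z\in\overline{\mathbb{D}_d}$, $$\Sigma_{2k}(z):=\begin{pmatrix}I_k&zI_k\\ \overline{z}I_k&I_k\end{pmatrix}.$$ $\mathbb{F}_1N_{n}(0,\Sigma)$ is the centred real Gaussian distribution on $\mathbb{R}^{n}$ with covariance matrix $\Sigma$; $\mathbb{F}_2N_{n}(0,\Sigma)$ is the centred proper (circularly symmetric) complex Gaussian distribution on $\mathbb{C}^{n}$ with covariance matrix $\mathbb{E}[VV^\ast]=\Sigma$ (so that $\mathbb{C}N_1(0,1)$ satisfies $\mathbb{E}|V|^2=1$). For $\mathbb{F}\in\{\mathbb{R},\mathbb{C}\}$, the Grothendieck constant $K_G^{\mathbb{F}}$ is the smallest constant $K>0$ such that for all $m,n\in\mathbb{N}$, all $m\times n$ matrices $(a_{ij})$ over $\mathbb{F}$, all $\mathbb{F}$-Hilbert spaces $H$ and all unit vectors $u_1,\dots,u_m,v_1,\dots,v_n\in H$, $$\Big|\sum_{i,j}a_{ij}\langle u_i,v_j\rangle_H\Big|\le K\sup\Big\{\Big|\sum_{i,j}a_{ij}p_iq_j\Big|:p_i,q_j\in\mathbb{F},\ |p_i|=1=|q_j|\ \forall i,j\Big\}.$$ *)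

(* Defs.v *)
From HB Require Import structures.
From mathcomp Require Import all_boot all_order all_algebra.
From mathcomp Require Import all_classical all_reals all_analysis.
From mathcomp Require Export complex.
Set Implicit Arguments.
Unset Strict Implicit.
Unset Printing Implicit Defensive.
Import Order.TTheory GRing.Theory Num.Theory.
Import numFieldNormedType.Exports.
Local Open Scope classical_set_scope.
Local Open Scope ring_scope.

(* The field F_d: the reals for d = 1, the complex numbers for d = 2 (every
   d != 1 yields the complex numbers; statements must assume d \in {1, 2}).
   Through the numFieldType structure, F_d carries its norm topology, and
   the norm of F_d takes its (real) values in F_d itself. *)
Definition Fd (R : realType) (d : nat) : numFieldType :=
  if d is 1 then (R : numFieldType) else (R[i] : numFieldType).

Definition sconj (R : realType) (d : nat) : Fd R d -> Fd R d :=
  match d return Fd R d -> Fd R d with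
  | 1 => id
  | _ => @conjc R
  end.

Definition Fd_of_real (R : realType) (d : nat) : R -> Fd R d :=
  match d return R -> Fd R d with
  | 1 => id
  | _ => fun x => x%:C%C
  end.

Definition sre (R : realType) (d : nat) : Fd R d -> R :=
  match d return Fd R d -> R with
  | 1 => id
  | _ => @complex.Re R
  end.

(* The absolute value as an element of R rather than of F_d. *)
Definition sabs (R : realType) (d : nat) (z : Fd R d) : R := sre `|z|.

Definition open_disk (R : realType) (d : nat) : set (Fd R d) :=
  [set z | `|z| < 1].

Definition closed_disk (R : realType) (d : nat) : set (Fd R d) :=
  closure (@open_disk R d).
Arguments open_disk : clear implicits.
Arguments closed_disk : clear implicits.

Definition Borel (T : ptopologicalType) := g_sigma_algebraType (@open T).

(* The centred normal law on R with variance v; normal_prob with a zero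
   standard deviation is not the point mass, whence the case distinction. *)
Definition centred_normal (R : realType) (v : R) : set R -> \bar R :=
  if v == 0 then \d_(0 : R) else normal_prob 0 (Num.sqrt v).

(* V ~ N_n(0, S): every linear combination a^T V is N(0, a^T S a)-distributed.
   S may be singular. *)
Definition real_gaussian (R : realType) (disp : measure_display)
    (T : measurableType disp) (P : probability T R) (n : nat)
    (V : T -> 'cV[R]_n) (S : 'M[R]_n) : Prop :=
  measurable_fun [set: T] (V : T -> Borel 'cV[R]_n) /\
  forall (a : 'cV[R]_n) (A : set R), measurable A ->
    P [set w | A ((a^T *m V w) 0 0)] = centred_normal ((a^T *m S *m a) 0 0) A.

(* V ~ CN_n(0, S): (Re V, Im V) is centred Gaussian with the covariance matrix
   that is equivalent to E[V V^*] = S and E[V V^T] = 0 (properness). *)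
Definition complex_gaussian (R : realType) (disp : measure_display)
    (T : measurableType disp) (P : probability T R) (n : nat)
    (V : T -> 'cV[R[i]]_n) (S : 'M[R[i]]_n) : Prop :=
  let ReS := map_mx (@complex.Re R) S in
  let ImS := map_mx (@complex.Im R) S in
  real_gaussian P
    (fun w => col_mx (map_mx (@complex.Re R) (V w))
                     (map_mx (@complex.Im R) (V w)))
    (2^-1 *: block_mx ReS (- ImS) ImS ReS).

Definition gaussian (R : realType) (d : nat) (disp : measure_display)
    (T : measurableType disp) (P : probability T R) (n : nat) :
    (T -> 'cV[Fd R d]_n) -> 'M[Fd R d]_n -> Prop :=
  match d return (T -> 'cV[Fd R d]_n) -> 'M[Fd R d]_n -> Prop with
  | 1 => @real_gaussian R disp T P n
  | _ => @complex_gaussian R disp T P n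
  end.

Definition sexpectation (R : realType) (d : nat) (disp : measure_display)
    (T : measurableType disp) (P : probability T R) :
    (T -> Fd R d) -> Fd R d :=
  match d return (T -> Fd R d) -> Fd R d with
  | 1 => fun X => fine ('E_P[X])%E
  | _ => fun X => (fine ('E_P[fun w => complex.Re (X w)])%E
                   +i* fine ('E_P[fun w => complex.Im (X w)])%E)%C
  end.

Definition Sigma2 (R : realType) (d k : nat) (z : Fd R d) :
    'M[Fd R d]_(k + k) :=
  block_mx 1%:M z%:M (sconj z)%:M 1%:M.

Definition is_homeomorphism (X Y : topologicalType) (A : set X) (B : set Y)
    (f : X -> Y) (g : Y -> X) : Prop :=
  [/\ set_fun A B f, set_fun B A g,
      {in A, cancel f g}, {in B, cancel g f} &
      {within A, continuous f} /\ {within B, continuous g}].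

(* The N-th partial sum of \sum_(n >= 1) a_n z^n. *)
Definition power_sum (R : realType) (d : nat) (a : nat -> R) (z : Fd R d)
    (N : nat) : Fd R d :=
  \sum_(1 <= n < N.+1) Fd_of_real d (a n) * z ^+ n.

Definition abs_power_series (R : realType) (d : nat) (a : nat -> R)
    (z : Fd R d) : Fd R d :=
  limn (power_sum (fun n => `|a n|) z).

(* K is admissible in Grothendieck's inequality over F_d. A Hilbert space is a
   complete normed space whose norm derives from a scalar product (linear in
   its first argument). *)
Definition grothendieck_bound (R : realType) (d : nat) (K : R) : Prop :=
  forall (m n : nat) (a : 'M[Fd R d]_(m, n))
    (H : completeNormedModType (Fd R d)) (dot : {dot H for @sconj R d}),
    (forall x : H, `|x| ^+ 2 = dot x x) ->
  forall (u : 'I_m -> H) (v : 'I_n -> H),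
    (forall i, `|u i| = 1) -> (forall j, `|v j| = 1) ->
  sabs (\sum_(i < m) \sum_(j < n) a i j * dot (u i) (v j)) <=
  K * sup [set x : R | exists (p : 'I_m -> Fd R d) (q : 'I_n -> Fd R d),
        [/\ forall i, `|p i| = 1, forall j, `|q j| = 1 &
            x = sabs (\sum_(i < m) \sum_(j < n) a i j * p i * q j)]].

(* The infimum is taken in the extended reals, so that the value would be +oo
   if no constant were admissible. The set of admissible constants being
   closed, the infimum of a nonempty such set is its least element. *)
Definition grothendieck_constant (R : realType) (d : nat) : \bar R :=
  ereal_inf [set K%:E | K in [set K : R | 0 < K /\ grothendieck_bound d K]].

(* Main.v *)
From HB Require Import structures.
Require Import Defs.
From mathcomp Require Import all_boot all_order all_algebra.
From mathcomp Require Import all_classical all_reals all_analysis.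
From mathcomp Require Import measurable_realfun ring lra.
Set Implicit Arguments.
Unset Strict Implicit.
Unset Printing Implicit Defensive.
Import Order.TTheory GRing.Theory Num.Theory.
Import numFieldNormedType.Exports.
Local Open Scope classical_set_scope.
Local Open Scope ring_scope.

(** Krivine's rounding scheme. For unit vectors u_i, v_j of a Hilbert space put
c_ij = dot u_i v_j. Let K be the matrix of size m + n whose off-diagonal block
has entries g (r c_ij) = sum_l beta_l r^l c_ij^l, and whose diagonal blocks are
given by the same series with |beta_l| for beta_l, applied to the scalar
products among the u_i and among the v_j. Up to conjugation by a diagonal matrix
of signs, each term is a nonnegative multiple of a Hadamard power of a Gram
matrix; so K is a Gram matrix, with diagonal sum_l |beta_l| r^l = 1. Hence there
are Gaussian vectors Z_i, W_j with E Z_i Z_i^* = I, E W_j W_j^* = I and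
E Z_i W_j^* = g (r c_ij) I, and by definition of h
E [b (Z_i) conj (b (W_j))] = h (g (r c_ij)) = r c_ij.
So r sum a_ij c_ij is the mean of sum a_ij b (Z_i) conj (b (W_j)), whose modulus
never exceeds the supremum over unimodular p, q. Dividing by r gives the bound.

The series is handled by truncation ([krivine_kernel]): the partial sums of
order N, with the missing mass put back on the diagonal, form an honest Gram
kernel, the rounding inequality ([rounding_le_sup]) holds for each N, and
continuity of h on the closed disk gives the limit. Gram kernels are represented
by explicit finite factorizations K i j = sum_q A_iq conj (A_jq) ([gram]), which are closed under sums, Hadamard products and diagonal
conjugation; a factorization of the original scalar products comes from
Gram-Schmidt ([gram_dot]).

The probabilistic input is the existence of these Gaussian vectors
([gaussian_family]): linear combinations of independent standard normal
variables with the rows of A as coefficients. That such combinations are normal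
is the convolution identity for normal densities ([normal_prob_convolution]),
iterated along a product space ([standard_normals_exist]). Both scalar fields
are treated together through real and imaginary parts, except where the Gaussian
law itself is defined differently; over the complex numbers independent real and
imaginary parts make the pseudo-covariance vanish
([complex_gaussian_linear]). *)

(** * Scalars: conjugation, real and imaginary parts, modulus *)

Lemma sconj_is_zmod_morphism (R : realType) (d : nat) :
  zmod_morphism (@sconj R d).
Proof. by case: d => [|[|d]] //= x y; exact: rmorphB. Qed.

Lemma sconj_is_monoid_morphism (R : realType) (d : nat) :
  monoid_morphism (@sconj R d).
Proof.
by case: d => [|[|d]] //=; split; [exact: rmorph1 |exact: rmorphM
  |exact: rmorph1 |exact: rmorphM].
Qed.

HB.instance Definition _ (R : realType) (d : nat) :=
  GRing.isZmodMorphism.Build _ _ _ (@sconj_is_zmod_morphism R d).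
HB.instance Definition _ (R : realType) (d : nat) :=
  GRing.isMonoidMorphism.Build _ _ _ (@sconj_is_monoid_morphism R d).

Lemma Fd_of_real_is_zmod_morphism (R : realType) (d : nat) :
  zmod_morphism (@Fd_of_real R d).
Proof. by case: d => [|[|d]] //= x y; rewrite rmorphB. Qed.

Lemma Fd_of_real_is_monoid_morphism (R : realType) (d : nat) :
  monoid_morphism (@Fd_of_real R d).
Proof.
by case: d => [|[|d]] //=; split=> // x y; rewrite rmorphM.
Qed.

HB.instance Definition _ (R : realType) (d : nat) :=
  GRing.isZmodMorphism.Build _ _ _ (@Fd_of_real_is_zmod_morphism R d).
HB.instance Definition _ (R : realType) (d : nat) :=
  GRing.isMonoidMorphism.Build _ _ _ (@Fd_of_real_is_monoid_morphism R d).

Lemma sre_is_zmod_morphism (R : realType) (d : nat) :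
  zmod_morphism (@sre R d).
Proof. by case: d => [|[|d]] //= [x1 x2] [y1 y2]. Qed.

HB.instance Definition _ (R : realType) (d : nat) :=
  GRing.isZmodMorphism.Build _ _ _ (@sre_is_zmod_morphism R d).

(** Zero over the reals, so that formulas in real and imaginary parts hold over
both fields. *)
Definition sim (R : realType) (d : nat) : Fd R d -> R :=
  match d return Fd R d -> R with
  | 1 => fun=> 0
  | _ => @complex.Im R
  end.

Lemma sim_is_zmod_morphism (R : realType) (d : nat) :
  zmod_morphism (@sim R d).
Proof.
case: d => [|[|d]] //=; try by move=> [x1 x2] [y1 y2].
by move=> x y; rewrite subr0.
Qed.

HB.instance Definition _ (R : realType) (d : nat) :=
  GRing.isZmodMorphism.Build _ _ _ (@sim_is_zmod_morphism R d).

Lemma sconjK (R : realType) (d : nat) : involutive (@sconj R d).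
Proof. by case: d => [|[|d]] //= x; exact: conjcK. Qed.

Lemma mul_sconj (R : realType) (d : nat) (z : Fd R d) :
  z * sconj z = `|z| ^+ 2.
Proof.
case: d z => [|[|d]] /= z; try exact: (esym (sqr_normc z)).
by rewrite real_normK ?num_real// expr2.
Qed.

Lemma norm_sconj (R : realType) (d : nat) (z : Fd R d) : `|sconj z| = `|z|.
Proof. by apply/eqP; rewrite -(@eqrXn2 _ 2)//; rewrite -!mul_sconj sconjK mulrC. Qed.

Lemma sconj_of_real (R : realType) (d : nat) (x : R) :
  sconj (Fd_of_real d x) = Fd_of_real d x.
Proof. by case: d => [|[|d]] //=; exact: conjc_real. Qed.

Lemma sre_sconj (R : realType) (d : nat) (z : Fd R d) : sre (sconj z) = sre z.
Proof. by case: d z => [|[|d]] //= []. Qed.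

Lemma sim_sconj (R : realType) (d : nat) (z : Fd R d) : sim (sconj z) = - sim z.
Proof. by case: d z => [|[|d]] //= z; [case: z|rewrite oppr0|case: z]. Qed.

Lemma sreM (R : realType) (d : nat) (z w : Fd R d) :
  sre (z * w) = sre z * sre w - sim z * sim w.
Proof.
by case: d z w => [|[|d]] /= z w; [case: z; case: w|rewrite mul0r subr0|
  case: z; case: w].
Qed.

Lemma simM (R : realType) (d : nat) (z w : Fd R d) :
  sim (z * w) = sre z * sim w + sim z * sre w.
Proof.
by case: d z w => [|[|d]] /= z w; [case: z; case: w|rewrite mulr0 mul0r addr0|
  case: z; case: w].
Qed.

Lemma ler_of_real (R : realType) (d : nat) (x y : R) :
  (Fd_of_real d x <= Fd_of_real d y) = (x <= y).
Proof. by case: d => [|[|d]] //=; rewrite lecR. Qed.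

Lemma ltr_of_real (R : realType) (d : nat) (x y : R) :
  (Fd_of_real d x < Fd_of_real d y) = (x < y).
Proof. by case: d => [|[|d]] //=; rewrite ltcR. Qed.

Lemma norm_of_real (R : realType) (d : nat) (x : R) :
  `|Fd_of_real d x| = Fd_of_real d `|x|.
Proof.
have nC : `|x%:C%C| = `|x|%:C%C by rewrite normc_def/= expr0n addr0 sqrtr_sqr.
by case: d => [|[|d]] //=; exact: nC.
Qed.

Lemma of_real_sabs (R : realType) (d : nat) (z : Fd R d) :
  Fd_of_real d (sabs z) = `|z|.
Proof.
have nC (w : R[i]) : (complex.Re `|w|)%:C%C = `|w| by rewrite normc_def.
by case: d z => [|[|d]] //= z; exact: nC.
Qed.

Lemma sabs_le (R : realType) (d : nat) (z : Fd R d) (x : R) :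
  (sabs z <= x) = (`|z| <= Fd_of_real d x).
Proof. by rewrite -of_real_sabs ler_of_real. Qed.

Lemma sabs_lt (R : realType) (d : nat) (z : Fd R d) (x : R) :
  (sabs z < x) = (`|z| < Fd_of_real d x).
Proof. by rewrite -of_real_sabs ltr_of_real. Qed.

Lemma sre_of_realM (R : realType) (d : nat) (x : R) (z : Fd R d) :
  sre (Fd_of_real d x * z) = x * sre z.
Proof. by case: d z => [|[|d]] //= [a c] /=; rewrite mul0r subr0. Qed.

Lemma ge0_Fd_of_real (R : realType) (d : nat) (z : Fd R d) :
  0 <= z -> z = Fd_of_real d (sre z).
Proof.
move=> z0; rewrite -[LHS]ger0_norm// -of_real_sabs; congr Fd_of_real.
by rewrite /sabs ger0_norm.
Qed.

Lemma sabsE (R : realType) (d : nat) (z : Fd R d) :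
  sabs z = Num.sqrt (sre z ^+ 2 + sim z ^+ 2).
Proof.
have nC (w : R[i]) :
    complex.Re `|w| = Num.sqrt (complex.Re w ^+ 2 + complex.Im w ^+ 2).
  by rewrite normc_def.
case: d z => [|[|d]] z; [exact: nC| |exact: nC].
by rewrite /sabs /= expr0n addr0 sqrtr_sqr.
Qed.

Lemma norm_sre_le_sabs (R : realType) (d : nat) (z : Fd R d) :
  `|sre z| <= sabs z.
Proof. by rewrite sabsE -sqrtr_sqr ler_wsqrtr// lerDl sqr_ge0. Qed.

Lemma norm_sim_le_sabs (R : realType) (d : nat) (z : Fd R d) :
  `|sim z| <= sabs z.
Proof. by rewrite sabsE -sqrtr_sqr ler_wsqrtr// lerDr sqr_ge0. Qed.

Lemma sre_le_sabs (R : realType) (d : nat) (z : Fd R d) : sre z <= sabs z.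
Proof. exact: le_trans (ler_norm _) (norm_sre_le_sabs z). Qed.

Lemma sabs_le_sum (R : realType) (d : nat) (z : Fd R d) :
  sabs z <= `|sre z| + `|sim z|.
Proof.
rewrite sabsE -(@ler_pXn2r _ 2) ?nnegrE ?sqrtr_ge0 ?addr_ge0//.
rewrite sqr_sqrtr ?addr_ge0 ?sqr_ge0// sqrrD !real_normK ?num_real//.
by rewrite addrAC lerDl mulrn_wge0// mulr_ge0.
Qed.

(** Multiplying by the conjugate phase turns a modulus into a real part, which
is linear and so commutes with expectations. *)
Lemma sabs_phase (R : realType) (d : nat) (z : Fd R d) :
  exists2 t : Fd R d, `|t| = 1 & sre (t * z) = sabs z.
Proof.
have [->|z0] := eqVneq z 0.
  by exists 1; rewrite ?normr1// mulr0 /sabs normr0.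
have nz : `|z| != 0 by rewrite normr_eq0.
exists (sconj z / `|z|).
  apply/eqP; rewrite -(@eqrXn2 _ 2)//.
  rewrite expr1n -mul_sconj rmorphM fmorphV /= sconjK.
  rewrite -[in sconj `|z|]of_real_sabs sconj_of_real of_real_sabs.
  rewrite mulrACA [sconj z * z]mulrC mul_sconj -invfM -expr2 divff//.
  by rewrite expf_neq0.
by rewrite mulrAC [sconj z * z]mulrC mul_sconj expr2 mulfK// /sabs.
Qed.

Lemma le1_closed_disk (R : realType) (d : nat) (z : Fd R d) :
  `|z| <= 1 -> closed_disk R d z.
Proof.
move=> z1 U /nbhs_ballP[e /= e0 zU].
have eE := ge0_Fd_of_real (ltW e0).
have e'0 : 0 < sre e by rewrite -(ltr_of_real d) -eE rmorph0.
(* (1 - t) z lies in the open disk, at distance at most t from z *)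
pose t : R := Num.min 2^-1 (sre e / 2).
have t0 : 0 < t by rewrite lt_min invr_gt0 ltr0n divr_gt0.
have t1 : t < 1 by rewrite gt_min invf_lt1// ltr1n.
have te : t < sre e by rewrite gt_min ltr_pdivrMr// ltr_pMr// ltr1n orbT.
exists (Fd_of_real d (1 - t) * z); split.
  rewrite /open_disk /= normrM norm_of_real (@ger0_norm _ (1 - t)) ?subr_ge0 ?ltW//.
  rewrite (le_lt_trans (ler_piMr _ z1))//.
    by rewrite -(rmorph0 (@Fd_of_real R d)) ler_of_real subr_ge0 ltW.
  by rewrite -(rmorph1 (@Fd_of_real R d)) ltr_of_real gtrBl.
apply: zU; rewrite /ball /= rmorphB rmorph1 mulrBl mul1r opprB addrCA subrr addr0.
rewrite normrM norm_of_real (@ger0_norm _ t) ?ltW// [ltRHS]eE.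
rewrite (le_lt_trans (ler_piMr _ z1)) ?ltr_of_real//.
by rewrite -(rmorph0 (@Fd_of_real R d)) ler_of_real ltW.
Qed.

Lemma cvg_Fd_of_real (R : realType) (d : nat) (f : nat -> R) (l : R) :
  f @ \oo --> l -> (fun n => Fd_of_real d (f n)) @ \oo --> Fd_of_real d l.
Proof.
move=> /cvgrPdist_lt fl; apply/cvgrPdist_lt => e e0.
have eE := ge0_Fd_of_real (ltW e0).
have e'0 : 0 < sre e by rewrite -(ltr_of_real d) -eE rmorph0.
apply: filterS (fl _ e'0) => n h.
by rewrite -rmorphB/= norm_of_real eE ltr_of_real.
Qed.

(** * Gram kernels *)

(** The factorization is indexed by an arbitrary finite type: sums of kernels
then use disjoint unions of index types, and products use pairs. *)
Definition gram (R : realType) (d : nat) (I : Type) (K : I -> I -> Fd R d) :=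
  exists (Q : finType) (A : I -> Q -> Fd R d),
    forall i j, K i j = \sum_q A i q * sconj (A j q).

Lemma gram0 (R : realType) (d : nat) (I : Type) :
  gram (fun _ _ : I => 0 : Fd R d).
Proof. by exists void, (fun _ _ => 0) => i j; rewrite big1// => q _; rewrite mul0r. Qed.

Lemma gram1 (R : realType) (d : nat) (I : Type) :
  gram (fun _ _ : I => 1 : Fd R d).
Proof.
exists unit, (fun _ _ => 1) => i j; rewrite (big_pred1 tt); last by case.
by rewrite rmorph1 mulr1.
Qed.

Lemma gramD (R : realType) (d : nat) (I : Type) (K L : I -> I -> Fd R d) :
  gram K -> gram L -> gram (fun i j => K i j + L i j).
Proof.
move=> [Q [A KA]] [S [B LB]]; exists (Q + S)%type.
exists (fun i x => match x with inl q => A i q | inr s => B i s end) => i j.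
by rewrite big_sumType/= KA LB.
Qed.

(** The Schur product theorem: the rows of the new factor are tensor products of
the old rows. *)
Lemma gramM (R : realType) (d : nat) (I : Type) (K L : I -> I -> Fd R d) :
  gram K -> gram L -> gram (fun i j => K i j * L i j).
Proof.
move=> [Q [A KA]] [S [B LB]]; exists (Q * S)%type.
exists (fun i x => A i x.1 * B i x.2) => i j.
rewrite KA LB big_distrlr/= pair_bigA/=; apply: eq_bigr => x _.
by rewrite rmorphM/= mulrACA.
Qed.

Lemma gramX (R : realType) (d : nat) (I : Type) (K : I -> I -> Fd R d) n :
  gram K -> gram (fun i j => K i j ^+ n).
Proof.
move=> gK; elim: n => [|n IH]; first exact: gram1.
have -> : (fun i j => K i j ^+ n.+1) = (fun i j => K i j * K i j ^+ n).
  by apply/funext => i; apply/funext => j; rewrite exprS.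
exact: gramM.
Qed.

(** Conjugation by a diagonal matrix, which covers both nonnegative weights
(f constant) and sign changes. *)
Lemma gram_scale (R : realType) (d : nat) (I : Type) (K : I -> I -> Fd R d)
    (f : I -> Fd R d) :
  gram K -> gram (fun i j => f i * sconj (f j) * K i j).
Proof.
move=> [Q [A KA]]; exists Q, (fun i q => f i * A i q) => i j.
by rewrite KA mulr_sumr; apply: eq_bigr => q _; rewrite rmorphM/= mulrACA.
Qed.

Lemma gram_sum (R : realType) (d : nat) (I : Type) (J : Type) (s : seq J)
    (K : J -> I -> I -> Fd R d) :
  (forall n, gram (K n)) -> gram (fun i j => \sum_(n <- s) K n i j).
Proof.
move=> gK; elim: s => [|n s IH].
  have -> : (fun i j => \sum_(n <- [::]) K n i j) = fun _ _ => 0.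
    by apply/funext => i; apply/funext => j; rewrite big_nil.
  exact: gram0.
have -> : (fun i j => \sum_(n <- n :: s) K n i j) =
    (fun i j => K n i j + \sum_(n <- s) K n i j).
  by apply/funext => i; apply/funext => j; rewrite big_cons.
exact: gramD.
Qed.

Lemma gram_delta (R : realType) (d : nat) (I : finType) :
  gram (fun i j : I => (i == j)%:R : Fd R d).
Proof.
exists I, (fun i q => (i == q)%:R) => i j.
rewrite (bigD1 j)//= big1 ?addr0 ?eqxx ?rmorph1 ?mulr1//.
by move=> q qj; rewrite [j == q]eq_sym (negbTE qj) rmorph0 mulr0.
Qed.

(** Cauchy-Schwarz, termwise from 2 x y <= x^2 + y^2. *)
Lemma gram_le1 (R : realType) (d : nat) (I : Type) (K : I -> I -> Fd R d) i j :
  gram K -> K i i = 1 -> K j j = 1 -> `|K i j| <= 1.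
Proof.
move=> [Q [A KA]] Ki Kj.
rewrite -(ler_pMn2r (isT : (0 < 2)%N)).
have -> : 1 *+ 2 = \sum_q (`|A i q| ^+ 2 + `|A j q| ^+ 2) :> Fd R d.
  rewrite big_split/= mulr2n -{1}Ki -Kj !KA.
  by congr (_ + _); apply: eq_bigr => q _; rewrite mul_sconj.
rewrite KA (le_trans (_ : _ <= (\sum_q `|A i q * sconj (A j q)|) *+ 2))//.
  by rewrite ler_pMn2r//; exact: ler_norm_sum.
rewrite -sumrMnl; apply: ler_sum => q _.
rewrite normrM norm_sconj -subr_ge0 addrAC -sqrrB.
by rewrite real_exprn_even_ge0// rpredB// normr_real.
Qed.

Lemma dotC (R : realType) (d : nat) (H : lmodType (Fd R d))
    (dot : {dot H for @sconj R d}) (x y : H) : dot x y = sconj (dot y x).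
Proof. by rewrite hermC expr0 mul1r. Qed.

Lemma dot_self_square (R : realType) (d : nat) (H : lmodType (Fd R d))
    (dot : {dot H for @sconj R d}) (y : H) : y != 0 ->
  exists2 c : Fd R d, c != 0 & sconj c = c /\ dot y y = c * c.
Proof.
move=> y0; have p := neq0_dnorm_gt0 (s := dot) y y0.
have E := ge0_Fd_of_real (ltW p).
have sp : 0 < sre (dot y y) by rewrite -(ltr_of_real d) -E rmorph0.
exists (Fd_of_real d (Num.sqrt (sre (dot y y)))).
  by rewrite gt_eqF// -(rmorph0 (@Fd_of_real R d)) ltr_of_real sqrtr_gt0.
by rewrite sconj_of_real -rmorphM/= -expr2 sqr_sqrtr ?(ltW sp).
Qed.

(** The Gram-Schmidt process, one vector at a time: a new basis vector is added
only if the remainder after projection is nonzero. *)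
Lemma orthonormal_span (R : realType) (d : nat) (H : lmodType (Fd R d))
    (dot : {dot H for @sconj R d}) (ws : seq H) :
  exists (Q : nat) (e : 'I_Q -> H),
    (forall p q, dot (e p) (e q) = (p == q)%:R) /\
    forall w, w \in ws -> w = \sum_q dot w (e q) *: e q.
Proof.
elim: ws => [|w ws [Q [e [eo ews]]]].
  by exists 0%N, (fun=> 0); split=> [[]|].
pose y := w - \sum_q dot w (e q) *: e q.
have ye p : dot y (e p) = 0.
  rewrite /y linearBl/= linear_sumlz/= (bigD1 p)//= linearZl_LR/= eo eqxx mulr1.
  rewrite big1 ?addr0 ?subrr// => q qp.
  by rewrite linearZl_LR/= eo (negbTE qp) mulr0.
have wE : w = \sum_q dot w (e q) *: e q + y by rewrite addrC subrK.
have [y0|y0] := eqVneq y 0.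
  exists Q, e; split=> // v; rewrite inE => /orP[/eqP ->|]; last exact: ews.
  by rewrite [LHS]wE y0 addr0.
have [c c0 [cc yy]] := dot_self_square dot y0.
have ey p : dot (e p) y = 0 by rewrite dotC ye rmorph0.
(* c is a real square root of dot y y, which normalizes y *)
pose e' (q : 'I_Q.+1) := if unlift ord_max q is Some p then e p else c^-1 *: y.
have e'S q : e' (widen_ord (leqnSn Q) q) = e q.
  rewrite /e' (_ : widen_ord _ q = lift ord_max q) ?liftK//.
  by apply/val_inj; rewrite /= /bump leqNgt ltn_ord.
have e'm : e' ord_max = c^-1 *: y by rewrite /e' unlift_none.
exists Q.+1, e'; split=> [p q|v vws].
  rewrite /e'; case: unliftP => [p'|] ->; case: unliftP => [q'|] ->.
  - by rewrite eo (inj_eq lift_inj).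
  - by rewrite linearZr_LR/= ey mulr0 eq_sym (negbTE (neq_lift _ _)).
  - by rewrite linearZl_LR/= ye mulr0 (negbTE (neq_lift _ _)).
  - rewrite linearZl_LR/= linearZr_LR/= yy fmorphV /= cc eqxx.
    by rewrite mulKf// mulVf.
rewrite big_ord_recr/=; under eq_bigr do rewrite e'S.
rewrite e'm linearZr_LR/= fmorphV /= cc.
move: vws; rewrite inE => /orP[/eqP ->|vws].
  have -> : dot w y = c * c.
    rewrite {1}wE linearDl/= linear_sumlz/= big1 ?add0r// => q _.
    by rewrite linearZl_LR/= ey mulr0.
  by rewrite mulKf// scalerA divff// scale1r.
have -> : dot v y = 0.
  rewrite (ews _ vws) linear_sumlz/= big1// => q _.
  by rewrite linearZl_LR/= ey mulr0.
by rewrite mulr0 scale0r addr0 -ews.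
Qed.

(** The factor consists of coordinates in an orthonormal family spanning the
given vectors. *)
Lemma gram_dot (R : realType) (d : nat) (H : lmodType (Fd R d))
    (dot : {dot H for @sconj R d}) (I : finType) (w : I -> H) :
  gram (fun i j => dot (w i) (w j)).
Proof.
have [Q [e [eo ews]]] := orthonormal_span dot (codom w).
exists 'I_Q, (fun i q => dot (w i) (e q)) => i j.
rewrite {1}(ews (w i)) ?codom_f// linear_sumlz/=; apply: eq_bigr => q _.
by rewrite linearZl_LR/= -dotC.
Qed.

(** * Sums of independent normal variables *)

Lemma measurable_affine (R : realType) (a c : R) :
  measurable_fun [set: R] (fun x : R => a * x + c).
Proof. by apply: measurable_funD => //; exact: mulrl_measurable. Qed.

(** Both sides are measures in A that agree on intervals. *)
Lemma lebesgue_measure_affine (R : realType) (a c : R) (A : set R) :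
  a != 0 -> measurable A ->
  (`|a|%:E * lebesgue_measure ((fun x : R => (a * x + c)%R) @^-1` A)
   = lebesgue_measure A)%E.
Proof.
move=> a0 mA.
pose phi : measurableTypeR R -> measurableTypeR R := fun x => a * x + c.
have mphi : measurable_fun [set: measurableTypeR R] phi
  by exact: measurable_affine.
pose mu :=
  mscale (NngNum (normr_ge0 a))
         (pushforward (@lebesgue_measure R) phi)
  : {measure set (measurableTypeR R) -> \bar R}.
suff -> : lebesgue_measure A = mu mphi A by [].
apply: lebesgue_measure_unique => //= _ [[x y]] _ <-.
rewrite /mscale/= /pushforward lebesgue_measure_itv/= lte_fin.
have [ap|an|aE] := ltrgtP 0 a; last by rewrite -aE eqxx in a0.
- rewrite (_ : _ @^-1` _ = `](x - c) / a, (y - c) / a]%classic); last first.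
    apply/seteqP; split=> z /=; rewrite !in_itv/= ltr_pdivrMr// ler_pdivlMr//;
    by rewrite ltrBlDr lerBrDr [z * a]mulrC.
  rewrite lebesgue_measure_itv/= lte_fin ltr_pM2r ?invr_gt0// ltrD2r.
  case: ifP => _; last by rewrite mule0.
  by rewrite gtr0_norm// -EFinB -EFinM -mulrBl mulrC divfK ?gt_eqF//; congr EFin; ring.
- rewrite (_ : _ @^-1` _ = `[(y - c) / a, (x - c) / a[%classic); last first.
    apply/seteqP; split=> z /=; rewrite !in_itv/= ltr_ndivlMr// ler_ndivrMr//;
    by rewrite lerBrDr ltrBlDr [z * a]mulrC andbC.
  rewrite lebesgue_measure_itv/= lte_fin ltr_nM2r ?invr_lt0// ltrD2r.
  case: ifP => _; last by rewrite mule0.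
  by rewrite ltr0_norm// -EFinB -EFinM -mulrBl mulNr mulrC divfK ?lt_eqF//;
    congr EFin; ring.
Qed.

Lemma ge0_integral_affine (R : realType) (a c : R) (f : R -> \bar R) :
  a != 0 -> measurable_fun [set: R] f -> (forall x, 0 <= f x)%E ->
  (`|a|%:E * \int[lebesgue_measure]_x f (a * x + c)%R
   = \int[lebesgue_measure]_x f x)%E.
Proof.
move=> a0 mf f0.
pose phi : measurableTypeR R -> measurableTypeR R := fun x => a * x + c.
have mphi : measurable_fun [set: measurableTypeR R] phi
  by exact: measurable_affine.
pose mu :=
  mscale (NngNum (normr_ge0 a))
         (pushforward (@lebesgue_measure R) phi)
  : {measure set (measurableTypeR R) -> \bar R}.
transitivity (\int[mu mphi]_x f x)%E.
  rewrite ge0_integral_mscale//= ge0_integral_pushforward//=.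
apply: eq_measure_integral => B mB _.
exact: lebesgue_measure_affine.
Qed.

(** The normal density is the Radon-Nikodym derivative of the normal law. *)
Lemma ge0_integral_normal_prob (R : realType) (m s : R) (f : R -> \bar R) :
  measurable_fun [set: R] f -> (forall x, 0 <= f x)%E ->
  (\int[normal_prob m s]_x `|f x| < +oo)%E ->
  (\int[normal_prob m s]_x f x =
   \int[lebesgue_measure]_x (f x * (normal_pdf m s x)%:E))%E.
Proof.
move=> mf f0 finf.
rewrite -(Radon_Nikodym_change_of_variables (normal_prob_dominates m s))//=;
  last by apply/integrableP; split.
apply: ae_eq_integral => //.
- apply: emeasurable_funM => //; apply: (measurable_int lebesgue_measure).
  by apply: Radon_Nikodym_integrable; exact: normal_prob_dominates.
- apply: emeasurable_funM => //=; apply/measurableT_comp => //=.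
  exact: measurable_normal_pdf.
- apply: ae_eqe_mul2l => /=.
  rewrite Radon_NikodymE//=; first exact: normal_prob_dominates.
  move=> dom; case: cid => /= g [h1 h2 h3].
  apply: integral_ae_eq => //=.
  + by apply/measurableT_comp => //; exact: measurable_normal_pdf.
  + by move=> E _ mE; rewrite -h3.
Qed.

(** Completing the square in x: the joint density of a centred normal x and of a
normal z with mean x factors through the law of z and the law of x given z. *)
Lemma normal_pdfM (R : realType) (s t x z : R) : 0 < s -> 0 < t ->
  normal_pdf 0 s x * normal_pdf x t z =
  normal_pdf 0 (Num.sqrt (s ^+ 2 + t ^+ 2)) z *
  normal_pdf (z * s ^+ 2 / (s ^+ 2 + t ^+ 2))
    (s * t / Num.sqrt (s ^+ 2 + t ^+ 2)) x.
Proof.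
move=> s0 t0.
have v0 : 0 < s ^+ 2 + t ^+ 2 by rewrite addr_gt0// exprn_gt0.
have w0 : 0 < Num.sqrt (s ^+ 2 + t ^+ 2) by rewrite sqrtr_gt0.
have wE : Num.sqrt (s ^+ 2 + t ^+ 2) ^+ 2 = s ^+ 2 + t ^+ 2.
  by rewrite sqr_sqrtr// ltW.
rewrite !normal_pdfE ?gt_eqF ?divr_gt0 ?mulr_gt0// /normal_peak /normal_fun.
rewrite mulrACA [RHS]mulrACA -!expRD -!invfM; congr (_^-1 * expR _).
  have pi0 : 0 <= (pi : R) by exact: pi_ge0.
  rewrite -!sqrtrM ?wE ?mulrn_wge0 ?mulr_ge0 ?sqr_ge0 ?(ltW v0) ?(ltW s0) ?(ltW t0)//.
  congr Num.sqrt; rewrite !exprMn exprVn wE.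
  by field; exact: lt0r_neq0.
rewrite !exprMn exprVn wE.
by field; rewrite !lt0r_neq0.
Qed.

Lemma measurable_normal_pdf2 (R : realType) (t : R) : t != 0 ->
  measurable_fun [set: R * R] (fun p => normal_pdf p.1 t p.2).
Proof.
move=> t0; rewrite (_ : (fun _ => _) =
    normal_pdf 0 t \o (fun p : R * R => p.2 - p.1)); last first.
  by apply/funext => p /=; rewrite !normal_pdfE// /normal_fun subr0.
apply: measurableT_comp; first exact: measurable_normal_pdf.
exact: measurable_funB.
Qed.

Lemma measurable_normal_prob_mean (R : realType) (t : R) (A : set R) :
  t != 0 -> measurable A ->
  measurable_fun [set: R] (fun x => normal_prob x t A).
Proof.
move=> t0 mA.
rewrite (_ : (fun _ => _) = fun x => \int[lebesgue_measure]_z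
    ((\1_A z)%:E * (normal_pdf x t z)%:E))%E; last first.
  apply/funext => x; rewrite /normal_prob integral_mkcond.
  apply: eq_integral => z _; rewrite patchE indicE.
  by case: (z \in A); rewrite ?mul1e ?mul0e.
apply: (@measurable_fun_fubini_tonelli_F _ _ (measurableTypeR R)
  (measurableTypeR R) R lebesgue_measure (fun p =>
    ((\1_A p.2)%:E * (normal_pdf p.1 t p.2)%:E)%E)) => /=;
  last by move=> p; rewrite -EFinM lee_fin mulr_ge0 ?normal_pdf_ge0.
apply: emeasurable_funM; apply/measurable_EFinP.
  apply: (@measurableT_comp _ _ _ _ _ _ (\1_A : R -> R)).
    exact: measurable_indic.
  exact: measurable_snd.
exact: measurable_normal_pdf2.
Qed.

(** By Tonelli the left-hand side is the integral over A of the marginal density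
of z, and normal_pdfM turns the inner integral into that of a normal density. *)
Lemma normal_prob_convolution (R : realType) (s t : R) (A : set R) :
  0 < s -> 0 < t -> measurable A ->
  (\int[normal_prob 0 s]_x normal_prob x t A
   = normal_prob 0 (Num.sqrt (s ^+ 2 + t ^+ 2)) A)%E.
Proof.
move=> s0 t0 mA.
rewrite ge0_integral_normal_prob; last first.
- apply: (@le_lt_trans _ _ (\int[normal_prob 0 s]_x cst 1 x)%E).
    apply: ge0_le_integral => //=.
      apply: measurableT_comp => //.
      by apply: measurable_normal_prob_mean => //; rewrite gt_eqF.
    by move=> x _; rewrite gee0_abs// probability_le1.
  rewrite integral_cst// mul1e.
  exact: le_lt_trans (probability_le1 (normal_prob 0 s) measurableT) (ltry _).
- by move=> x; exact: measure_ge0.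
- by apply: measurable_normal_prob_mean => //; rewrite gt_eqF.
pose f (p : measurableTypeR R * measurableTypeR R) : \bar R :=
  ((\1_A p.2)%:E * ((normal_pdf 0 s p.1)%:E * (normal_pdf p.1 t p.2)%:E))%E.
have mf : measurable_fun setT f.
  apply: emeasurable_funM; first apply/measurable_EFinP.
    apply: (@measurableT_comp _ _ _ _ _ _ (\1_A : R -> R)).
      exact: measurable_indic.
    exact: measurable_snd.
  apply: emeasurable_funM; apply/measurable_EFinP.
    apply: (@measurableT_comp _ _ _ _ _ _ (normal_pdf 0 s)).
      exact: measurable_normal_pdf.
    exact: measurable_fst.
  by apply: measurable_normal_pdf2; rewrite gt_eqF.
have f0 p : (0 <= f p)%E.
  by rewrite /f -!EFinM lee_fin !mulr_ge0 ?normal_pdf_ge0.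
transitivity (\int[lebesgue_measure]_x \int[lebesgue_measure]_z f (x, z))%E.
  apply: eq_integral => x _.
  rewrite /normal_prob muleC -ge0_integralZl//; last 3 first.
  - by apply/measurable_EFinP/measurable_funTS; exact: measurable_normal_pdf.
  - by move=> z _; rewrite lee_fin normal_pdf_ge0.
  - by rewrite lee_fin normal_pdf_ge0.
  rewrite integral_mkcond; apply: eq_integral => z _.
  by rewrite patchE /f indicE /=; case: (z \in A); rewrite ?mul1e ?mul0e.
rewrite (fubini_tonelli f)//.
rewrite /normal_prob [RHS]integral_mkcond; apply: eq_integral => z _.
rewrite patchE /f /= indicE; case: (z \in A) => /=; last first.
  by under eq_integral do rewrite mul0e; rewrite integral0.
under eq_integral do rewrite mul1e -EFinM normal_pdfM// EFinM.
rewrite ge0_integralZl//=; last 3 first.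
- by apply/measurable_EFinP; exact: measurable_normal_pdf.
- by move=> x _; rewrite lee_fin normal_pdf_ge0.
- by rewrite lee_fin normal_pdf_ge0.
by rewrite integral_normal_pdf mule1.
Qed.

Lemma normal_prob_affine (R : realType) (a m : R) (A : set R) :
  a != 0 -> measurable A ->
  normal_prob 0 1 [set y | A (m + a * y)] = normal_prob m `|a| A.
Proof.
move=> a0 mA.
rewrite /normal_prob [RHS]integral_mkcond.
rewrite -(@ge0_integral_affine _ a m)//; last 2 first.
- apply/measurable_restrict => //=; rewrite ?setTI//.
  by apply/measurable_EFinP/measurable_funTS; exact: measurable_normal_pdf.
- move=> x; rewrite patchE; case: ifP => // _.
  by rewrite lee_fin normal_pdf_ge0.
rewrite -ge0_integralZl//=; last 2 first.
- apply: (@measurableT_comp _ _ _ _ _ _ ((fun x => (normal_pdf m `|a| x)%:E) \_ A)).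
    apply/measurable_restrict => //=; rewrite ?setTI//.
    by apply/measurable_EFinP/measurable_funTS; exact: measurable_normal_pdf.
  exact: measurable_affine.
- move=> x _; rewrite patchE; case: ifP => // _.
  by rewrite lee_fin normal_pdf_ge0.
rewrite integral_mkcond; apply: eq_integral => y _.
rewrite !patchE.
rewrite (_ : (a * y + m \in A) = (y \in [set y | A (m + a * y)])); last first.
  by apply/idP/idP; rewrite !inE /= addrC.
case: ifP => _; last by rewrite mule0.
rewrite -EFinM !normal_pdfE ?oner_neq0 ?normr_eq0//; congr EFin.
rewrite /normal_peak /normal_fun addrK subr0 mulrA; congr (_ * expR _).
  have an : 0 < `|a| by rewrite normr_gt0.
  rewrite expr1n mul1r -mulrnAr sqrtrM ?sqr_ge0// sqrtr_sqr normr_id.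
  by rewrite invfM mulrA divff ?mul1r// gt_eqF.
rewrite real_normK ?num_real//.
by rewrite expr1n exprMn; field.
Qed.

(** The product measure under a name that can carry the structure of a
probability. *)
Definition product_prob d1 d2 (T1 : measurableType d1) (T2 : measurableType d2)
    (R : realType) (P : probability T1 R) (Q : probability T2 R) :
  set (T1 * T2) -> \bar R := (P \x Q)%E.

HB.instance Definition _ d1 d2 (T1 : measurableType d1) (T2 : measurableType d2)
    (R : realType) (P : probability T1 R) (Q : probability T2 R) :=
  Measure.on (product_prob P Q).

Lemma product_prob_setT d1 d2 (T1 : measurableType d1) (T2 : measurableType d2)
    (R : realType) (P : probability T1 R) (Q : probability T2 R) :
  product_prob P Q [set: T1 * T2] = 1%E.
Proof.
rewrite /product_prob -setXTT product_measure1E//.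
by rewrite -[RHS]mule1; congr (_ * _)%E; exact: probability_setT.
Qed.

HB.instance Definition _ d1 d2 (T1 : measurableType d1) (T2 : measurableType d2)
    (R : realType) (P : probability T1 R) (Q : probability T2 R) :=
  Measure_isProbability.Build _ _ _ (product_prob P Q) (product_prob_setT P Q).

(** Integrating out the second coordinate leaves the normal law with mean X and
standard deviation |a|. The degenerate cases v = 0 and a = 0 are separate, since
a normal law of variance zero is a point mass. *)
Lemma product_prob_normal_sum d (T : measurableType d) (R : realType)
    (P : probability T R) (X : T -> R) (v a : R) :
  measurable_fun [set: T] X -> 0 <= v ->
  (forall A, measurable A -> P [set w | A (X w)] = centred_normal v A) ->
  forall A, measurable A ->
    product_prob P (normal_prob 0 1) [set p | A (X p.1 + a * p.2)] =
    centred_normal (v + a ^+ 2) A.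
Proof.
move=> mX v0 XP A mA; rewrite /product_prob /product_measure1 /=.
have [->|a0] := eqVneq a 0.
  rewrite expr0n addr0 -XP//.
  rewrite (_ : [set w | A (X w)] = X @^-1` A)//.
  have mXA : measurable (X @^-1` A) by rewrite -[X @^-1` A]setTI; exact: mX.
  rewrite -[X in P X]setIT -integral_indic//.
  apply: eq_integral => w _; rewrite indicE.
  rewrite (_ : xsection _ w = if w \in X @^-1` A then setT else set0).
    by case: ifP => _; [exact: probability_setT|rewrite measure0].
  apply/seteqP; split=> y; rewrite /xsection /= !inE /= mul0r addr0.
    by move=> Aw; rewrite mem_set.
  by case: ifPn => //; rewrite inE.
have a1 : `|a| != 0 by rewrite normr_eq0.
transitivity (\int[P]_w ((fun x => normal_prob x `|a| A) \o X) w)%E.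
  apply: eq_integral => w _; rewrite /= -normal_prob_affine//; congr (normal_prob 0 1).
  by apply/seteqP; split=> y; rewrite /xsection /= inE.
have mF : measurable_fun [set: R] (fun x => normal_prob x `|a| A).
  exact: measurable_normal_prob_mean.
(* the law of the sum depends on X only through its own law *)
have mX' : measurable_fun [set: T] (X : T -> measurableTypeR R) by exact: mX.
rewrite -[[set: T]](preimage_setT X) -(ge0_integral_pushforward mX')//.
rewrite /centred_normal in XP *.
have [v00|vn0] := eqVneq v 0.
  rewrite v00 eqxx in XP; rewrite v00 add0r sqrf_eq0 (negbTE a0) sqrtr_sqr.
  transitivity (\int[\d_(0%R : measurableTypeR R)]_x normal_prob x `|a| A)%E.
    by apply: eq_measure_integral => B mB _; exact: XP.
  by rewrite integral_dirac// diracT mul1e.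
have vp : 0 < v by rewrite lt_neqAle eq_sym vn0.
rewrite (negbTE vn0) in XP.
rewrite gt_eqF ?addr_gt0// ?exprn_even_gt0//.
transitivity (\int[normal_prob 0 (Num.sqrt v)]_x normal_prob x `|a| A)%E.
  by apply: eq_measure_integral => B mB _; exact: XP.
have sv0 : 0 < Num.sqrt v by rewrite sqrtr_gt0.
have an0 : 0 < `|a| by rewrite normr_gt0.
have vaE : Num.sqrt v ^+ 2 + `|a| ^+ 2 = v + a ^+ 2.
  by rewrite sqr_sqrtr ?(ltW vp)// real_normK ?num_real.
rewrite -vaE.
exact: normal_prob_convolution.
Qed.

Lemma standard_normals_exist (R : realType) (M : nat) :
  exists (d : measure_display) (T : measurableType d) (P : probability T R)
      (xi : 'I_M -> T -> R),
    (forall q, measurable_fun [set: T] (xi q)) /\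
    forall (a : 'I_M -> R) (A : set R), measurable A ->
      P [set w | A (\sum_q a q * xi q w)] =
      centred_normal (\sum_q a q ^+ 2) A.
Proof.
elim: M => [|M [d [T [P [xi [mxi xiP]]]]]].
  exists default_measure_display, unit, (\d_tt : probability _ _).
  exists (fun _ _ => 0); split=> // a A mA.
  rewrite /centred_normal !big_ord0 eqxx.
  by rewrite /dirac !indicE; congr (_%:R%:E); congr nat_of_bool;
    apply/idP/idP; rewrite !inE.
exists _, (T * measurableTypeR R)%type, (product_prob P (normal_prob 0 1)).
exists (fun q p => if unlift ord_max q is Some q' then xi q' p.1 else p.2).
split=> [q|a A mA].
  case: (unlift _ q) => [q'|]; last exact: measurable_snd.
  by apply: measurableT_comp; [exact: mxi|exact: measurable_fst].
have sumE (w : T) y : \sum_q a q * (if unlift ord_max q is Some q'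
    then xi q' w else y) =
    \sum_(q < M) a (widen_ord (leqnSn M) q) * xi q w + a ord_max * y.
  rewrite big_ord_recr/= unlift_none; congr (_ + _); apply: eq_bigr => q _.
  rewrite (_ : widen_ord _ q = lift ord_max q) ?liftK//.
  by apply/val_inj; rewrite /= /bump leqNgt ltn_ord.
under eq_fun do rewrite sumE.
rewrite big_ord_recr/=.
apply: (@product_prob_normal_sum _ _ _ P (fun w : T =>
  \sum_(q < M) a (widen_ord (leqnSn M) q) * xi q w)) => //.
- apply: measurable_sum => q; apply: measurable_funM => //.
- by apply: sumr_ge0 => q _; exact: sqr_ge0.
- exact: xiP.
Qed.

(** Joint standard normality in the form in which it is used: the law of every
linear combination. *)
Definition standard_normals (R : realType) (disp : measure_display)
    (T : measurableType disp) (P : probability T R) (J : finType)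
    (xi : J -> T -> R) : Prop :=
  (forall l, measurable_fun [set: T] (xi l)) /\
  forall (a : J -> R) (A : set R), measurable A ->
    P [set w | A (\sum_l a l * xi l w)] = centred_normal (\sum_l a l ^+ 2) A.

Lemma standard_normals_family (R : realType) (J : finType) :
  exists (disp : measure_display) (T : measurableType disp)
    (P : probability T R) (xi : J -> T -> R), standard_normals P xi.
Proof.
have [disp [T [P [xi [mxi xiP]]]]] := standard_normals_exist R #|J|.
exists disp, T, P, (fun l => xi (enum_rank l)); split=> [l|a A mA]; first exact: mxi.
have eE (f : 'I_#|J| -> R) : \sum_(l : J) f (enum_rank l) = \sum_q f q.
  by rewrite [RHS](reindex enum_rank)//; exact: onW_bij (enum_rank_bij J).
have -> : \sum_l a l ^+ 2 = \sum_(q < #|J|) a (enum_val q) ^+ 2.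
  by rewrite -eE; apply: eq_bigr => l _; rewrite enum_rankK.
rewrite -xiP//; congr (P _); apply: eq_set => w; congr A.
by rewrite -eE; apply: eq_bigr => l _; rewrite enum_rankK.
Qed.

(** * Borel measurability of scalars and vectors *)

Definition Fd_of_rat (R : realType) (d : nat) (q : rat * rat) : Fd R d :=
  match d return Fd R d with
  | 1 => ratr q.1
  | _ => (ratr q.1 +i* ratr q.2)%C
  end.

Lemma rat_near (R : realType) (x e : R) : 0 < e ->
  exists q : rat, `|x - ratr q| < e.
Proof.
move=> e0; have xe : x - e < x + e by rewrite ltrBlDr -addrA ltrDl addr_gt0.
have [q] := rat_in_itvoo xe; rewrite in_itv/= => /andP[q1 q2].
by exists q; rewrite ltr_norml; apply/andP; split; lra.
Qed.

Lemma Fd_of_rat_dense (R : realType) (d : nat) (x : Fd R d) (e : R) : 0 < e ->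
  exists q, sabs (x - Fd_of_rat R d q) < e.
Proof.
move=> e0; have e20 : 0 < e / 2 by rewrite divr_gt0.
have [q1 hq1] := rat_near (sre x) e20; have [q2 hq2] := rat_near (sim x) e20.
exists (q1, q2); rewrite (le_lt_trans (sabs_le_sum _))// [ltRHS](splitr e).
have -> : sre (x - Fd_of_rat R d (q1, q2)) = sre x - ratr q1.
  by rewrite raddfB/=; congr (_ - _); case: d x {hq1 hq2} => [|[|d]].
rewrite ltr_leD// ltW// (le_lt_trans _ hq2)// raddfB/=.
by case: d x {hq1} hq2 => [|[|d]] //= x _; rewrite subrr normr0.
Qed.

(** The topology of a vector space over a separable field has a countable base
of balls with rational centres, and preimages of balls are described by the
coordinates. *)
Lemma measurable_fun_cV (R : realType) (d n : nat) (disp : measure_display)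
    (T : measurableType disp) (V : T -> 'cV[Fd R d]_n) :
  (forall i, measurable_fun [set: T] (fun w => sre (V w i 0))) ->
  (forall i, measurable_fun [set: T] (fun w => sim (V w i 0))) ->
  measurable_fun [set: T] (V : T -> Borel 'cV[Fd R d]_n).
Proof.
move=> mre mim; apply: (@measurability _ _ T (Borel 'cV[Fd R d]_n) setT V
  (@open 'cV[Fd R d]_n)) => //.
move=> _ [U oU <-]; rewrite setTI.
have mbox (q : 'I_n -> rat * rat) (k : nat) : measurable
    (\bigcap_(i in [set: 'I_n])
      [set w | sabs (V w i 0 - Fd_of_rat R d (q i)) < k.+1%:R^-1]).
  apply: fin_bigcap_measurable => [|i _]; first exact: finite_finset.
  rewrite (_ : [set _ | _] = (fun w =>
      (sre (V w i 0) - sre (Fd_of_rat R d (q i))) ^+ 2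
    + (sim (V w i 0) - sim (Fd_of_rat R d (q i))) ^+ 2) @^-1`
      `]-oo, (k.+1%:R^-1) ^+ 2[%classic); last first.
    apply/seteqP; split=> w /=; rewrite in_itv/= -!raddfB sabsE => h.
      rewrite -ltr_sqrt ?exprn_gt0 ?invr_gt0// sqrtr_sqr ger0_norm//.
    by rewrite -[ltRHS]ger0_norm// -sqrtr_sqr ltr_sqrt// exprn_gt0 ?invr_gt0.
  rewrite -[X in measurable X]setTI; apply: (_ : measurable_fun _ _) => //.
  by apply: measurable_funD; apply: measurable_funX; apply: measurable_funB.
pose box (x : {ffun 'I_n -> rat * rat} * nat) : set T :=
  \bigcap_(i in [set: 'I_n])
    [set w | sabs (V w i 0 - Fd_of_rat R d (x.1 i)) < x.2.+1%:R^-1].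
pose inO (x : {ffun 'I_n -> rat * rat} * nat) := `[< forall y : 'cV[Fd R d]_n,
  (forall i, sabs (y i 0 - Fd_of_rat R d (x.1 i)) < x.2.+1%:R^-1) -> U y >].
(* U is the union of the boxes with rational data that it contains *)
rewrite (_ : V @^-1` U = \bigcup_x (if inO x then box x else set0)); last first.
  apply/seteqP; split=> [w /= Uw|w [x _]]; last first.
    by case: ifP => // /asboolP h hb; apply: h => i; exact: hb.
  have : nbhs (V w) U by exact: open_nbhs_nbhs.
  move=> /nbhs_ballP[e /= e0 hO].
  have eE := ge0_Fd_of_real (ltW e0).
  have e'0 : 0 < sre e by rewrite -(ltr_of_real d) -eE rmorph0.
  have e20 : 0 < sre e / 2 by rewrite divr_gt0.
  have [k _ /(_ k (leqnn k)) /= hk] := near_infty_natSinv_lt (PosNum e20).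
  have /choice[q hq] : forall i, exists q,
      sabs (V w i 0 - Fd_of_rat R d q) < k.+1%:R^-1.
    by move=> i; apply: Fd_of_rat_dense; rewrite invr_gt0.
  exists ([ffun i => q i], k) => //.
  rewrite ifT; first by move=> i _ /=; rewrite ffunE; exact: hq.
  apply/asboolP => y /= hy; apply: hO; split=> // i j.
  rewrite (ord1 j) /ball /= eE -sabs_lt.
  have := hy i; rewrite ffunE => hyi.
  rewrite sabs_lt -[V w i 0 - _](subrKA (Fd_of_rat R d (q i))).
  rewrite (le_lt_trans (ler_normD _ _))// [sre e]splitr rmorphD/=.
  rewrite ltrD// -sabs_lt; first exact: lt_trans (hq i) hk.
  by rewrite /sabs distrC -/(sabs _); exact: lt_trans hyi hk.
apply: countable_bigcupT_measurable => [|x]; first exact: countableP.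
by case: ifP => _; [exact: mbox|exact: measurable0].
Qed.

(** An additive map bounded by the modulus is 1-Lipschitz, hence continuous. *)
Lemma measurable_fun_additive_le_sabs (R : realType) (d : nat) (disp : measure_display)
    (T : measurableType disp) (phi : {additive Fd R d -> R})
    (X : T -> Fd R d) :
  (forall z, `|phi z| <= sabs z) ->
  measurable_fun [set: T] (X : T -> Borel (Fd R d)) ->
  measurable_fun [set: T] (fun w => phi (X w)).
Proof.
move=> phi_le mX; apply: (measurability _ (RGenOInfty.measurableE R)) => //.
move=> _ [_ [a ->] <-]; rewrite setTI.
rewrite (_ : _ @^-1` _ = X @^-1` [set z | a < phi z]); last first.
  by apply/seteqP; split=> w /=; rewrite in_itv/= andbT.
rewrite -[X in measurable X]setTI; apply: mX => //.
apply: sub_sigma_algebra; rewrite openE => z /= az.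
apply/nbhs_ballP; exists (Fd_of_real d (phi z - a)) => /=.
  by rewrite -(rmorph0 (@Fd_of_real R d)) ltr_of_real subr_gt0.
move=> y; rewrite /ball /= -sabs_lt => /(le_lt_trans (phi_le _)).
move=> /(le_lt_trans (ler_norm _)).
by rewrite raddfB/= ltrD2l ltrN2.
Qed.

Lemma measurable_fun_sre (R : realType) (d : nat) (disp : measure_display)
    (T : measurableType disp) (X : T -> Fd R d) :
  measurable_fun [set: T] (X : T -> Borel (Fd R d)) ->
  measurable_fun [set: T] (fun w => sre (X w)).
Proof. exact: measurable_fun_additive_le_sabs (@norm_sre_le_sabs R d). Qed.

Lemma measurable_fun_sim (R : realType) (d : nat) (disp : measure_display)
    (T : measurableType disp) (X : T -> Fd R d) :
  measurable_fun [set: T] (X : T -> Borel (Fd R d)) ->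
  measurable_fun [set: T] (fun w => sim (X w)).
Proof. exact: measurable_fun_additive_le_sabs (@norm_sim_le_sabs R d). Qed.

(** * Gaussian vectors with prescribed covariance *)

Lemma real_gaussian_linear (R : realType) (disp : measure_display)
    (T : measurableType disp) (P : probability T R) (J : finType)
    (xi : J -> T -> R) (n : nat) (V : T -> 'cV[R]_n) (B : 'I_n -> J -> R)
    (S : 'M[R]_n) :
  standard_normals P xi ->
  (forall w s, V w s 0 = \sum_l B s l * xi l w) ->
  (forall s t, S s t = \sum_l B s l * B t l) ->
  real_gaussian P V S.
Proof.
move=> [mxi xiP] VE SE; split.
  apply: (@measurable_fun_cV R 1 n _ _ V) => s /=; last exact: measurable_cst.
  under eq_fun do rewrite VE.
  by apply: measurable_sum => l; apply: measurable_funM.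
move=> a A mA.
have -> : (a^T *m S *m a) 0 0 = \sum_l (\sum_s a s 0 * B s l) ^+ 2.
  transitivity (\sum_t \sum_s \sum_l a s 0 * B s l * (a t 0 * B t l)).
    rewrite mxE; apply: eq_bigr => t _; rewrite mxE mulr_suml.
    apply: eq_bigr => s _; rewrite !mxE SE mulr_sumr mulr_suml.
    by apply: eq_bigr => l _; ring.
  rewrite exchange_big; under eq_bigr do rewrite exchange_big.
  rewrite exchange_big; apply: eq_bigr => l _.
  by rewrite expr2 big_distrlr.
rewrite -xiP//; congr (P _); apply: eq_set => w; congr A.
rewrite mxE; under eq_bigr do rewrite mxE VE mulr_sumr.
rewrite exchange_big; apply: eq_bigr => l _ /=.
by rewrite mulr_suml; apply: eq_bigr => s _; rewrite mulrA.
Qed.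

(** The two hypotheses on C give covariance S and pseudo-covariance 0. Taking
real and imaginary parts of their sum and difference yields the four blocks of
the real covariance matrix. *)
Lemma complex_gaussian_linear (R : realType) (disp : measure_display)
    (T : measurableType disp) (P : probability T R) (J : finType)
    (xi : J -> T -> R) (n : nat) (V : T -> 'cV[R[i]]_n)
    (C : 'I_n -> J -> R[i]) (S : 'M[R[i]]_n) :
  standard_normals P xi ->
  (forall w s, V w s 0 = \sum_l C s l * (xi l w)%:C%C) ->
  (forall s t, S s t = \sum_l C s l * conjc (C t l)) ->
  (forall s t, \sum_l C s l * C t l = 0) ->
  complex_gaussian P V S.
Proof.
move=> nxi VE SE C0.
(* real parts first, then imaginary parts *)
pose B (s : 'I_(n + n)) l := match fintype.split s with
  | inl s => complex.Re (C s l) | inr s => complex.Im (C s l) end.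
apply: (real_gaussian_linear (B := B) nxi) => [w s|s t].
  rewrite /B mxE; case: (fintype.split s) => {}s; rewrite mxE VE raddf_sum;
  apply: eq_bigr => l _; case: (C s l) => c1 c2 /=; rewrite mulr0 ?subr0 ?add0r//.
have ReE s' t' : complex.Re (S s' t') = \sum_l
    (complex.Re (C s' l) * complex.Re (C t' l) +
     complex.Im (C s' l) * complex.Im (C t' l)).
  rewrite SE raddf_sum; apply: eq_bigr => l _.
  by case: (C s' l) => a b; case: (C t' l) => a' b' /=; ring.
have ImE s' t' : complex.Im (S s' t') = \sum_l
    (complex.Im (C s' l) * complex.Re (C t' l) -
     complex.Re (C s' l) * complex.Im (C t' l)).
  rewrite SE raddf_sum; apply: eq_bigr => l _.
  by case: (C s' l) => a b; case: (C t' l) => a' b' /=; ring.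
have Re0 s' t' : \sum_l (complex.Re (C s' l) * complex.Re (C t' l) -
     complex.Im (C s' l) * complex.Im (C t' l)) = 0.
  have /(congr1 (@complex.Re R)) := C0 s' t'.
  rewrite raddf_sum => E; rewrite -[RHS]E; apply: eq_bigr => l _.
  by case: (C s' l) => a b; case: (C t' l) => a' b' /=; ring.
have Im0 s' t' : \sum_l (complex.Im (C s' l) * complex.Re (C t' l) +
     complex.Re (C s' l) * complex.Im (C t' l)) = 0.
  have /(congr1 (@complex.Im R)) := C0 s' t'.
  rewrite raddf_sum => E; rewrite -[RHS]E; apply: eq_bigr => l _.
  by case: (C s' l) => a b; case: (C t' l) => a' b' /=; ring.
rewrite /B 2!mxE; case: (fintype.split s) => s'; rewrite mxE;
  case: (fintype.split t) => t'; rewrite !mxE.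
- rewrite ReE -[X in _ * X]addr0 -[X in _ * (_ + X)](Re0 s' t') -big_split/= mulr_sumr.
  by apply: eq_bigr => l _; field.
- rewrite ImE -sumrN -[X in _ * X]addr0 -[X in _ * (_ + X)](Im0 s' t') -big_split/= mulr_sumr.
  by apply: eq_bigr => l _; field.
- rewrite ImE -[X in _ * X]addr0 -[X in _ * (_ + X)](Im0 s' t') -big_split/= mulr_sumr.
  by apply: eq_bigr => l _; field.
- rewrite ReE -[X in _ * X]subr0 -[X in _ * (_ - X)](Re0 s' t') -sumrB mulr_sumr.
  by apply: eq_bigr => l _; field.
Qed.

(** A coordinate of the stacked vector is given by its block, i or j, and its
position in the block. *)
Lemma Sigma2E (R : realType) (d k : nat) (I : Type) (K : I -> I -> Fd R d)
    (i j : I) (s t : 'I_(k + k)) :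
  K i i = 1 -> K j j = 1 -> K j i = sconj (K i j) ->
  let blk s := match fintype.split s with inl _ => i | inr _ => j end in
  let pos s := match fintype.split s with inl c => c | inr c => c end in
  Sigma2 k (K i j) s t = K (blk s) (blk t) * (pos s == pos t)%:R.
Proof.
move=> Ki Kj Kji blk pos; rewrite /blk /pos /Sigma2 mxE.
case: (fintype.split s) => s'; rewrite mxE; case: (fintype.split t) => t';
  by rewrite ?Ki ?Kj ?Kji ?mul1r !mxE ?mulr_natr.
Qed.

Lemma sum_pair (V : nmodType) (Q S : finType) (G : Q * S -> V) :
  \sum_p G p = \sum_q \sum_x G (q, x).
Proof. by rewrite pair_bigA; apply: eq_bigr => -[]. Qed.

(** The vector Z_i is the row A_i of a Gram factor applied to independent
standard vectors, so that all pairs (Z_i, Z_j) are jointly Gaussian with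
cross-covariance K i j I. *)
Lemma gaussian_family (R : realType) (d k : nat) (I : Type)
    (K : I -> I -> Fd R d) : d = 1%N \/ d = 2%N ->
  gram K -> (forall i, K i i = 1) ->
  exists (disp : measure_display) (T : measurableType disp)
    (P : probability T R) (Z : I -> T -> 'cV[Fd R d]_k),
    (forall i, measurable_fun [set: T] (Z i : T -> Borel 'cV[Fd R d]_k)) /\
    forall i j, gaussian P (fun w => col_mx (Z i w) (Z j w)) (Sigma2 k (K i j)).
Proof.
move=> hd [Q [A KA]] K1.
have Kji i j : K j i = sconj (K i j).
  rewrite !KA rmorph_sum; apply: eq_bigr => q _.
  by rewrite rmorphM/= sconjK mulrC.
have delta (c c' : 'I_k) (f : 'I_k -> Fd R d) :
    \sum_x f x * (c == x)%:R * (c' == x)%:R = f c * (c == c')%:R.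
  rewrite (bigD1 c)//= eqxx mulr1 big1 ?addr0 1?eq_sym// => x xc.
  by rewrite [c == x]eq_sym (negbTE xc) mulr0 mul0r.
case: hd => dE; subst d.
- have [disp [T [P [xi nxi]]]] := standard_normals_family R (Q * 'I_k)%type.
  exists disp, T, P, (fun i w => \col_c \sum_l A i l.1 * (c == l.2)%:R * xi l w).
  split=> [i|i j].
    apply: (@measurable_fun_cV R 1) => c /=; last exact: measurable_cst.
    under eq_fun do rewrite mxE.
    by apply: measurable_sum => l; apply: measurable_funM => //; case: nxi.
  apply: (real_gaussian_linear (B := fun s l =>
      A (match fintype.split s with inl _ => i | inr _ => j end) l.1 *
      ((match fintype.split s with inl c => c | inr c => c end) == l.2)%:R) nxi).
    by move=> w s; rewrite mxE; case: (fintype.split s) => c; rewrite mxE.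
  move=> s t; rewrite (Sigma2E s t (K1 i) (K1 j) (Kji i j)) /=.
  rewrite KA mulr_suml sum_pair/=.
  apply: eq_bigr => q _; rewrite -(delta _ _ (fun=> _)).
  by apply: eq_bigr => x _; rewrite -mulrA mulrACA.
- have [disp [T [P [xi nxi]]]] := standard_normals_family R (Q * 'I_k * bool)%type.
  have aa : Num.sqrt 2^-1 * Num.sqrt 2^-1 = 2^-1 :> R.
    by rewrite -expr2 sqr_sqrtr// invr_ge0.
  (* weights of the real and imaginary parts of a standard complex normal *)
  pose u (e : bool) : R[i] :=
    if e then (0 +i* Num.sqrt 2^-1)%C else (Num.sqrt 2^-1 +i* 0)%C.
  have u1 : \sum_e u e * conjc (u e) = 1.
    apply/eqP; rewrite big_bool eq_complex /=.
    by apply/andP; split; apply/eqP; lra.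
  have u0 : \sum_e u e * u e = 0.
    apply/eqP; rewrite big_bool eq_complex /=.
    by apply/andP; split; apply/eqP; lra.
  have ucov (a a' : R[i]) (e e' : bool) :
      \sum_x (a * e%:R * u x) * conjc (a' * e'%:R * u x) =
      a * conjc a' * e%:R * e'%:R.
    rewrite -[RHS]mulr1 -[X in _ = _ * X]u1 mulr_sumr; apply: eq_bigr => x _.
    have cM (v w : R[i]) : conjc (v * w) = conjc v * conjc w by exact: rmorphM.
    rewrite !cM.
    have -> : conjc (e'%:R : R[i]) = e'%:R by exact: conjc_nat.
    by rewrite mulrACA; congr (_ * _); rewrite mulrACA mulrA.
  pose C i c (l : Q * 'I_k * bool) := A i l.1.1 * (c == l.1.2)%:R * u l.2.
  exists disp, T, P, (fun i w => \col_c \sum_l C i c l * (xi l w)%:C%C).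
  split=> [i|i j].
    apply: (@measurable_fun_cV R 2) => c /=.
      under eq_fun do rewrite mxE raddf_sum/=.
      apply: measurable_sum => l; case: (C i c l) => a b /=.
      under eq_fun do rewrite mulr0 subr0.
      by apply: measurable_funM => //; case: nxi.
    under eq_fun do rewrite mxE raddf_sum/=.
    apply: measurable_sum => l; case: (C i c l) => a b /=.
    under eq_fun do rewrite mulr0 add0r.
    by apply: measurable_funM => //; case: nxi.
  apply: (complex_gaussian_linear (C := fun s =>
      C (match fintype.split s with inl _ => i | inr _ => j end)
        (match fintype.split s with inl c => c | inr c => c end)) nxi).
  + by move=> w s; rewrite mxE; case: (fintype.split s) => c; rewrite mxE.
  + move=> s t; rewrite (Sigma2E s t (K1 i) (K1 j) (Kji i j)) /=.
    rewrite sum_pair/=.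
    rewrite KA mulr_suml.
    rewrite sum_pair/=.
    apply: eq_bigr => q _; rewrite -(delta _ _ (fun=> _)).
    apply: eq_bigr => x _; apply: esym.
    exact: (ucov (A _ q) (A _ q) (_ == x) (_ == x)).
  + move=> s t.
    rewrite sum_pair/=.
    rewrite big1// => x _; rewrite /C /=.
    under eq_bigr do rewrite mulrACA.
    by rewrite -mulr_sumr u0 mulr0.
Qed.

(** * Rounding *)

Lemma bounded_measurable_integrable (R : realType) (disp : measure_display)
    (T : measurableType disp) (P : probability T R) (f : T -> R) (M : R) :
  measurable_fun [set: T] f -> (forall w, `|f w| <= M) ->
  P.-integrable [set: T] (EFin \o f).
Proof.
move=> mf fM; apply: measurable_bounded_integrable => //.
  by rewrite (le_lt_trans (probability_le1 P measurableT))// ltry.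
exists M; split; first exact: num_real.
by move=> x Mx w _ /=; rewrite (le_trans (fM w))// ltW.
Qed.

Lemma Rintegral_sum (R : realType) (disp : measure_display)
    (T : measurableType disp) (P : probability T R) (I : Type) (s : seq I)
    (f : I -> T -> R) :
  (forall i, P.-integrable [set: T] (EFin \o f i)) ->
  P.-integrable [set: T] (EFin \o (fun w => \sum_(i <- s) f i w)) /\
  \int[P]_w (\sum_(i <- s) f i w) = \sum_(i <- s) \int[P]_w f i w.
Proof.
move=> fi; elim: s => [|i s [IHi IH]].
  rewrite big_nil; have -> : (fun w => \sum_(i <- [::]) f i w) = fun=> 0.
    by apply/funext => w; rewrite big_nil.
  split; first exact: finite_measure_integrable_cst.
  by rewrite Rintegral_cst// mul0r.
have -> : (fun w => \sum_(i <- i :: s) f i w) =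
    (fun w => f i w + \sum_(i <- s) f i w).
  by apply/funext => w; rewrite big_cons.
rewrite big_cons RintegralD// IH; split=> //.
by have := integrableD measurableT (fi i) IHi.
Qed.

(** Written as one real integral, so that linear combinations over either field
reduce to sums of real integrals. *)
Lemma sreM_sexpectation (R : realType) (d : nat) (disp : measure_display)
    (T : measurableType disp) (P : probability T R) (X : T -> Fd R d)
    (c : Fd R d) (M : R) :
  measurable_fun [set: T] (fun w => sre (X w)) ->
  measurable_fun [set: T] (fun w => sim (X w)) ->
  (forall w, sabs (X w) <= M) ->
  P.-integrable [set: T] (EFin \o (fun w => sre (c * X w))) /\
  sre (c * sexpectation P X) = \int[P]_w sre (c * X w).
Proof.
move=> mre mim XM.
have ire : P.-integrable [set: T] (EFin \o (fun w => sre (X w))).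
  apply: (@bounded_measurable_integrable _ _ _ P _ M) => // w.
  exact: le_trans (norm_sre_le_sabs _) (XM w).
have iim : P.-integrable [set: T] (EFin \o (fun w => sim (X w))).
  apply: (@bounded_measurable_integrable _ _ _ P _ M) => // w.
  exact: le_trans (norm_sim_le_sabs _) (XM w).
have sreE : sre (sexpectation P X) = \int[P]_w sre (X w).
  case: d X {c mre mim XM ire iim} => [|[|d]] X;
  by rewrite /sexpectation/= unlock.
have simE : sim (sexpectation P X) = \int[P]_w sim (X w).
  case: d X {c mre mim XM ire iim sreE} => [|[|d]] X;
  rewrite /sexpectation/= ?unlock//.
  by rewrite Rintegral_cst// mul0r.
have ire' := integrableZl measurableT (sre c) ire.
have iim' := integrableZl measurableT (sim c) iim.
have -> : (fun w => sre (c * X w)) =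
    (fun w => sre c * sre (X w) - sim c * sim (X w)).
  by apply/funext => w; rewrite sreM.
split; first by have := integrableB measurableT ire' iim'.
by rewrite sreM sreE simE RintegralB// !RintegralZl.
Qed.

(** After a rotation the modulus of the combination of means is a real part: the
mean of a real part which is bounded pointwise by s. *)
Lemma sabs_sum_sexpectation_le (R : realType) (d : nat) (disp : measure_display)
    (T : measurableType disp) (P : probability T R) (I : finType)
    (a : I -> Fd R d) (X : I -> T -> Fd R d) (M s : R) :
  (forall i, measurable_fun [set: T] (fun w => sre (X i w))) ->
  (forall i, measurable_fun [set: T] (fun w => sim (X i w))) ->
  (forall i w, sabs (X i w) <= M) ->
  (forall w, sabs (\sum_i a i * X i w) <= s) ->
  sabs (\sum_i a i * sexpectation P (X i)) <= s.
Proof.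
move=> mre mim XM Xs.
have [t t1 <-] := sabs_phase (\sum_i a i * sexpectation P (X i)).
rewrite mulr_sumr raddf_sum/=.
have hX i := sreM_sexpectation P (t * a i) (mre i) (mim i) (XM i).
under eq_bigr do rewrite mulrA (hX _).2.
have [iS <-] := Rintegral_sum (index_enum I) (fun i => (hX i).1).
rewrite -[leRHS]mulr1 -[X in s * X](_ : fine (P setT) = 1); last first.
  by rewrite probability_setT.
rewrite -Rintegral_cst//; apply: le_Rintegral => //.
  exact: finite_measure_integrable_cst.
move=> w _; under eq_bigr do rewrite -mulrA.
rewrite -raddf_sum -mulr_sumr (le_trans (sre_le_sabs _))//.
by rewrite /sabs normrM t1 mul1r; exact: Xs.
Qed.

Lemma unimodular_sum_le_sup (R : realType) (d m n : nat)
    (a : 'M[Fd R d]_(m, n)) (p : 'I_m -> Fd R d) (q : 'I_n -> Fd R d) :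
  (forall i, `|p i| = 1) -> (forall j, `|q j| = 1) ->
  sabs (\sum_(i < m) \sum_(j < n) a i j * p i * q j) <=
  sup [set x : R | exists (p : 'I_m -> Fd R d) (q : 'I_n -> Fd R d),
        [/\ forall i, `|p i| = 1, forall j, `|q j| = 1 &
            x = sabs (\sum_(i < m) \sum_(j < n) a i j * p i * q j)]].
Proof.
move=> p1 q1; apply: ub_le_sup; last by exists p, q.
exists (\sum_(i < m) \sum_(j < n) sabs (a i j)) => _ [p' [q' [p'1 q'1 ->]]].
rewrite sabs_le rmorph_sum/= (le_trans (ler_norm_sum _ _ _))//.
apply: ler_sum => i _; rewrite rmorph_sum/= (le_trans (ler_norm_sum _ _ _))//.
by apply: ler_sum => j _; rewrite !normrM p'1 q'1 !mulr1 of_real_sabs.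
Qed.

(** Pointwise, b (Z_i) and conj (b (W_j)) are an admissible choice of unimodular
numbers, and the mean of the product is h at the covariance. *)
Lemma rounding_le_sup (R : realType) (d k : nat)
    (hd : d = 1%N \/ d = 2%N)
    (b : 'cV[Fd R d]_k -> Fd R d)
    (b_unimodular : forall x, `|b x| = 1)
    (b_measurable : measurable_fun [set: Borel 'cV[Fd R d]_k]
       (b : Borel 'cV[Fd R d]_k -> Borel (Fd R d)))
    (h : Fd R d -> Fd R d)
    (hE : forall z, closed_disk R d z ->
       forall (disp : measure_display) (T : measurableType disp)
         (P : probability T R) (Z W : T -> 'cV[Fd R d]_k),
       gaussian P (fun w => col_mx (Z w) (W w)) (Sigma2 k z) ->
       h z = sexpectation P (fun w => b (Z w) * sconj (b (W w))))
    (m n : nat) (a : 'M[Fd R d]_(m, n))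
    (K : 'I_m + 'I_n -> 'I_m + 'I_n -> Fd R d) :
  gram K -> (forall x, K x x = 1) ->
  sabs (\sum_(i < m) \sum_(j < n) a i j * h (K (inl i) (inr j))) <=
  sup [set x : R | exists (p : 'I_m -> Fd R d) (q : 'I_n -> Fd R d),
        [/\ forall i, `|p i| = 1, forall j, `|q j| = 1 &
            x = sabs (\sum_(i < m) \sum_(j < n) a i j * p i * q j)]].
Proof.
move=> gK K1.
have [disp [T [P [Z [mZ ZG]]]]] := gaussian_family k hd gK K1.
pose X x w := b (Z x w).
have mX x : measurable_fun [set: T] (X x : T -> Borel (Fd R d)).
  by apply: (measurableT_comp b_measurable); exact: mZ.
have mre x := measurable_fun_sre (mX x).
have mim x := measurable_fun_sim (mX x).
pose Y (ij : 'I_m * 'I_n) w := X (inl ij.1) w * sconj (X (inr ij.2) w).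
have -> : \sum_(i < m) \sum_(j < n) a i j * h (K (inl i) (inr j)) =
    \sum_ij a ij.1 ij.2 * sexpectation P (Y ij).
  rewrite pair_bigA; apply: eq_bigr => ij _; congr (_ * _).
  by apply: hE (ZG _ _); apply: le1_closed_disk; exact: gram_le1.
apply: (@sabs_sum_sexpectation_le _ _ _ _ _ _ _ _ 1).
- move=> ij; under eq_fun do rewrite sreM sre_sconj sim_sconj.
  by apply: measurable_funB; apply: measurable_funM => //; apply: measurable_funN.
- move=> ij; under eq_fun do rewrite simM sre_sconj sim_sconj.
  by apply: measurable_funD; apply: measurable_funM => //; apply: measurable_funN.
- by move=> ij w; rewrite sabs_le rmorph1 normrM norm_sconj !b_unimodular mulr1.
move=> w.
rewrite (_ : \sum_ij _ = \sum_(i < m) \sum_(j < n)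
    a i j * X (inl i) w * sconj (X (inr j) w)); last first.
  by rewrite pair_bigA; apply: eq_bigr => ij _; rewrite mulrA.
by apply: unimodular_sum_le_sup => [i|j]; rewrite ?norm_sconj b_unimodular.
Qed.

(** * Krivine's kernel and the bound *)

(** The partial sums increase to the value 1 of the series; summability of beta
makes them converge, so that the limit in the series is a genuine one. *)
Lemma abs_power_sum_le1 (R : realType) (d : nat) (beta : nat -> R) (r : R) :
  (\sum_(1 <= n <oo) `|beta n|%:E < +oo)%E -> 0 < r -> r < 1 ->
  abs_power_series beta (Fd_of_real d r) = 1 ->
  forall N, \sum_(1 <= n < N.+1) `|beta n| * r ^+ n <= 1.
Proof.
move=> bs r0 r1 fr; pose F N : R := \sum_(1 <= n < N.+1) `|beta n| * r ^+ n.
have F_ge0 n : 0 <= `|beta n| * r ^+ n by rewrite mulr_ge0// exprn_ge0// ltW.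
have ndF : nondecreasing_seq F.
  apply/nondecreasing_seqP => N; rewrite /F [leRHS]big_nat_recr//=.
  by rewrite lerDl.
have s0 : (0 <= \sum_(1 <= n <oo) `|beta n|%:E)%E.
  by apply: nneseries_ge0 => n _ _; rewrite lee_fin.
have ubF : has_ubound (range F).
  exists (fine (\sum_(1 <= n <oo) `|beta n|%:E)%E) => _ [N _ <-].
  rewrite -lee_fin fineK ?ge0_fin_numE//.
  rewrite (le_trans _ (@nneseries_lim_ge _ (fun n => `|beta n|%:E) xpredT 1 N.+1 _))//.
  rewrite sumEFin lee_fin; apply: ler_sum => n _.
  by rewrite ler_piMr// exprn_ile1// ltW.
have cF := nondecreasing_is_cvgn ndF ubF.
have psE : power_sum (fun n => `|beta n|) (Fd_of_real d r) =
    fun N => Fd_of_real d (F N).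
  apply/funext => N; rewrite /power_sum /F rmorph_sum; apply: eq_bigr => n _.
  by rewrite rmorphM rmorphXn.
have limF : limn F = 1.
  apply/eqP; rewrite eq_le -!(ler_of_real d) -eq_le rmorph1 -fr; apply/eqP.
  rewrite /abs_power_series psE; apply/esym/cvg_lim; first exact: norm_hausdorff.
  exact: cvg_Fd_of_real.
by move=> N; rewrite -limF; exact: nondecreasing_cvgn_le.
Qed.

(** The truncated Krivine kernel. Its diagonal blocks use |beta_l| and its
off-diagonal block beta_l, which is Gram because the sign of beta_l can be moved
to one of the two families of vectors. *)
Lemma krivine_kernel (R : realType) (d m n : nat) (beta : nat -> R) (r : R)
    (c : 'I_m + 'I_n -> 'I_m + 'I_n -> Fd R d) (N : nat) :
  0 < r -> \sum_(1 <= l < N.+1) `|beta l| * r ^+ l <= 1 ->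
  gram c -> (forall al, c al al = 1) ->
  exists K : 'I_m + 'I_n -> 'I_m + 'I_n -> Fd R d,
    [/\ gram K, forall al, K al al = 1 &
      forall i j, K (inl i) (inr j) =
        power_sum beta (Fd_of_real d r * c (inl i) (inr j)) N].
Proof.
move=> r_gt0 f1 gc c1.
pose f := \sum_(1 <= l < N.+1) `|beta l| * r ^+ l.
(* the sign goes to the second family only, where it is squared on the
   diagonal block *)
pose e l (al : 'I_m + 'I_n) : R :=
  Num.sqrt (`|beta l| * r ^+ l) * (if al is inl _ then 1 else Num.sg (beta l)).
(* the last term restores the unit diagonal that truncation loses *)
pose K al be := \sum_(1 <= l < N.+1) Fd_of_real d (e l al) *
    sconj (Fd_of_real d (e l be)) * c al be ^+ l +
  Fd_of_real d (Num.sqrt (1 - f)) * sconj (Fd_of_real d (Num.sqrt (1 - f)))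
    * (al == be)%:R.
have b0 l : 0 <= `|beta l| * r ^+ l by rewrite mulr_ge0// exprn_ge0// ltW.
exists K; split.
- apply: gramD; last exact: gram_scale (@gram_delta R d _).
  by apply: gram_sum => l; apply: gram_scale; exact: gramX.
- move=> al.
  rewrite /K eqxx mulr1 sconj_of_real -rmorphM -expr2 sqr_sqrtr ?subr_ge0//.
  rewrite rmorphB rmorph1 /f rmorph_sum addrC -addrA -sumrN -big_split.
  rewrite big1 ?addr0// => l _; apply/eqP; rewrite /= addrC subr_eq0; apply/eqP.
  rewrite c1 expr1n mulr1 sconj_of_real -rmorphM; congr Fd_of_real.
  rewrite /e mulrACA -expr2 sqr_sqrtr//; case: al => _; first by rewrite !mulr1.
  have [->|bl] := eqVneq (beta l) 0; first by rewrite normr0 !mul0r.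
  by rewrite -expr2 sqr_sg bl mulr1.
- move=> i j; rewrite /K mulr0 addr0; apply: eq_bigr => l _.
  have -> : Fd_of_real d (beta l) * (Fd_of_real d r * c (inl i) (inr j)) ^+ l =
      Fd_of_real d (beta l * r ^+ l) * c (inl i) (inr j) ^+ l.
    by rewrite exprMn mulrA rmorphM rmorphXn.
  rewrite sconj_of_real -rmorphM; congr (Fd_of_real d _ * _).
  by rewrite /e mulr1 mulrA -expr2 sqr_sqrtr// mulrAC [_ * Num.sg _]mulrC -numEsg.
Qed.

Theorem mainTheorem3 (R : realType) (d k : nat)
    (hd : d = 1%N \/ d = 2%N) (hk : (0 < k)%N)
    (b : 'cV[Fd R d]_k -> Fd R d)
    (b_unimodular : forall x, `|b x| = 1)
    (b_measurable : measurable_fun [set: Borel 'cV[Fd R d]_k]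
       (b : Borel 'cV[Fd R d]_k -> Borel (Fd R d)))
    (h : Fd R d -> Fd R d)
    (hE : forall z, closed_disk R d z ->
       forall (disp : measure_display) (T : measurableType disp)
         (P : probability T R) (Z W : T -> 'cV[Fd R d]_k),
       gaussian P (fun w => col_mx (Z w) (W w)) (Sigma2 k z) ->
       h z = sexpectation P (fun w => b (Z w) * sconj (b (W w))))
    (h0 : h 0 = 0)
    (g : Fd R d -> Fd R d)
    (h_homeo : is_homeomorphism (closed_disk R d) (closed_disk R d) h g)
    (beta : nat -> R)
    (g_series : forall z, closed_disk R d z ->
       power_sum beta z @ \oo --> g z)
    (beta_summable : (\sum_(1 <= n <oo) `|beta n|%:E < +oo)%E)
    (r : R) (r_gt0 : 0 < r) (r_lt1 : r < 1)
    (fr : abs_power_series beta (Fd_of_real d r) = 1) :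
  (grothendieck_constant R d <= (1 / r)%:E)%E.
Proof.
have f1 := abs_power_sum_le1 beta_summable r_gt0 r_lt1 fr.
apply: ereal_inf_lbound; exists (1 / r) => //; split; first by rewrite divr_gt0.
move=> m n a H dot dotE u v u1 v1.
set S := sup _.
pose x (al : 'I_m + 'I_n) : H := match al with inl i => u i | inr j => v j end.
pose c al be : Fd R d := dot (x al) (x be).
have c1 al : c al al = 1.
  by rewrite /c -dotE; case: al => i /=; rewrite ?u1 ?v1 expr1n.
have gc : gram c by exact: gram_dot.
have rc_disk i j : closed_disk R d (Fd_of_real d r * c (inl i) (inr j)).
  apply: le1_closed_disk; rewrite normrM norm_of_real (gtr0_norm r_gt0).
  rewrite mulr_ile1 ?(gram_le1 gc)//.
    by rewrite -(rmorph0 (@Fd_of_real R d)) ler_of_real ltW.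
  by rewrite -(rmorph1 (@Fd_of_real R d)) ler_of_real ltW.
have krivine N := krivine_kernel r_gt0 (f1 N) gc c1.
pose s N i j := power_sum beta (Fd_of_real d r * c (inl i) (inr j)) N.
have s_disk N i j : closed_disk R d (s N i j).
  have [K [gK K1 KE]] := krivine N.
  by rewrite /s -KE; apply: le1_closed_disk; exact: gram_le1.
have hs N : sabs (\sum_(i < m) \sum_(j < n) a i j * h (s N i j)) <= S.
  have [K [gK K1 KE]] := krivine N.
  have := rounding_le_sup hd b_unimodular b_measurable hE a gK K1.
  by under eq_bigr do under eq_bigr do rewrite KE.
have [hset gset hg gh [hcont gcont]] := h_homeo.
(* at the limit the value of h is linear again in the scalar product *)
have h_lim i j : (fun N => h (s N i j)) @ \oo -->
    Fd_of_real d r * c (inl i) (inr j).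
  rewrite -[X in _ --> X]gh ?inE//.
  have /subspace_continuousP hc := hcont.
  have gd := gset _ (rc_disk i j).
  move=> U /(hc _ gd) /= hU.
  have [N _ NU] := g_series _ (rc_disk i j) _ hU.
  by exists N => // l Nl; exact: NU l Nl (s_disk l i j).
have lim_sum : (fun N => \sum_(i < m) \sum_(j < n) a i j * h (s N i j)) @ \oo -->
    Fd_of_real d r * \sum_(i < m) \sum_(j < n) a i j * c (inl i) (inr j).
  rewrite mulr_sumr; under [X in _ --> X]eq_bigr do rewrite mulr_sumr.
  apply: cvg_big => [|i _]; first exact: add_continuous.
  apply: cvg_big => [|j _]; first exact: add_continuous.
  rewrite mulrCA; apply: cvgMl_tmp; exact: h_lim.
rewrite mul1r -[leLHS](mulKf (lt0r_neq0 r_gt0)) ler_pM2l ?invr_gt0//.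
have <- : sabs (Fd_of_real d r *
    \sum_(i < m) \sum_(j < n) a i j * c (inl i) (inr j)) =
  r * sabs (\sum_(i < m) \sum_(j < n) a i j * dot (u i) (v j)).
  by rewrite /sabs normrM norm_of_real (gtr0_norm r_gt0) sre_of_realM.
apply/ler_addgt0Pr => eps eps0.
move/cvgrPdist_lt : lim_sum => /(_ (Fd_of_real d eps)) [].
  by rewrite -(rmorph0 (@Fd_of_real R d)) ltr_of_real.
move=> N _ /(_ N (leqnn N)) yy.
rewrite sabs_le -[X in `|X|](subrK (\sum_(i < m) \sum_(j < n) a i j * h (s N i j))).
rewrite (le_trans (ler_normD _ _))// addrC rmorphD lerD//.
  by rewrite -sabs_le; exact: hs.
exact: ltW.
Qed.
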